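(* Let $k,d\in\mathbb{N}$ with $d\geq 2$, let $\boldsymbol{\alpha}_1,\ldots,\boldsymbol{\alpha}_d$ be points in $\mathbb{R}^k$, and set $\boldsymbol{\alpha}=(\boldsymbol{\alpha}_1,\ldots,\boldsymbol{\alpha}_d)$. Let $r\geq 1$ be real and let $m\in\{0,1,\ldots,d\}$ be the number of points $\boldsymbol{\alpha}_i$ with Euclidean length strictly greater than $r$. Suppose $m$ is even and that the points in $\boldsymbol{\alpha}$ with Euclidean length greater than $r$ occur in pairs of equal length. Then $$\left(\prod_{i=1}^{d}\max\{1,|\boldsymbol{\alpha}_i|\}\right)^{2d-3}\geq (2r)^{d(1-d)}\prod_{1\leq i<j\leq d}|\boldsymbol{\alpha}_i-\boldsymbol{\alpha}_j|^{2}.$$ Moreover, the exponent $2d-3$ in this inequality is sharp.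
   Context: Here $|\cdot|$ denotes the Euclidean norm on $\mathbb{R}^k$. The quantity $\prod_{i=1}^{d}\max\{1,|\boldsymbol{\alpha}_i|\}$ is the Mahler-measure analogue of the point configuration and $\prod_{1\leq i<j\leq d}|\boldsymbol{\alpha}_i-\boldsymbol{\alpha}_j|^{2}$ its discriminant analogue (minus its logarithm is the discrete logarithmic energy of the configuration). *)

(* Defs.v *)
From HB Require Import structures.
From mathcomp Require Import all_boot all_order all_algebra.
From mathcomp Require Import reals exp.

Set Implicit Arguments.
Unset Strict Implicit.
Unset Printing Implicit Defensive.

Import Order.TTheory GRing.Theory Num.Theory.

Local Open Scope ring_scope.

(* Not the canonical norm `|x| of 'rV[R]_k, which is the sup norm. *)
Definition enorm (R : realType) (k : nat) (x : 'rV[R]_k) : R :=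
  Num.sqrt (\sum_(i < k) x 0 i ^+ 2).

Definition mahler (R : realType) (k d : nat) (alpha : 'I_d -> 'rV[R]_k) : R :=
  \prod_(i < d) Num.max 1 (enorm (alpha i)).

Definition disc (R : realType) (k d : nat) (alpha : 'I_d -> 'rV[R]_k) : R :=
  \prod_(i < d) \prod_(j < d | (i < j)%N) enorm (alpha i - alpha j) ^+ 2.

(* Indices rather than points, so that repeated points are counted with
   multiplicity. *)
Definition longer (R : realType) (k d : nat) (r : R)
    (alpha : 'I_d -> 'rV[R]_k) : {set 'I_d} :=
  [set i | r < enorm (alpha i)].

Definition equal_length_pairs (R : realType) (k d : nat)
    (alpha : 'I_d -> 'rV[R]_k) (A : {set 'I_d}) : Prop :=
  exists2 P : {set {set 'I_d}}, partition P A &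
    forall B, B \in P -> exists i j : 'I_d,
      [/\ i != j, B = [set i; j] & enorm (alpha i) = enorm (alpha j)].

Definition admissible (R : realType) (k d : nat) (r : R)
    (alpha : 'I_d -> 'rV[R]_k) : Prop :=
  ~~ odd #|longer r alpha| /\ equal_length_pairs alpha (longer r alpha).

(* Main.v *)
(* With w_i = max(r, |alpha_i|) / r >= 1, each factor |alpha_i - alpha_j| is at
   most 2 r max(w_i, w_j) <= 2 r w_i w_j. Using the last bound for all ordered
   pairs would give the exponent 2d - 2 for each w_i. The equality of lengths
   saves one power of each w_i > 1, since max(w_i, w_j) = w_i when j is the
   partner of i; this gives 2d - 3, without sorting the points by length.
   For sharpness, put two points at t and -t on a line, the others fixed and
   distinct in the unit ball: the Mahler product is t^2 while the discriminant
   grows like t^(4d - 6). *)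
Require Import Defs.
From HB Require Import structures.
From mathcomp Require Import all_boot all_order all_algebra.
From mathcomp Require Import reals exp.
From mathcomp Require Import ring lra zify.

Set Implicit Arguments.
Unset Strict Implicit.
Unset Printing Implicit Defensive.

Import Order.TTheory GRing.Theory Num.Theory.

Local Open Scope ring_scope.

(** * Products over ordered pairs of distinct indices *)

Lemma prod_lt_symm (R : comNzRingType) (d : nat) (F : 'I_d -> 'I_d -> R) :
  (forall i j, F i j = F j i) ->
  \prod_(i < d) \prod_(j < d | (i < j)%N) F i j ^+ 2 =
  \prod_(i < d) \prod_(j < d | j != i) F i j.
Proof.
move=> Fsym.
have -> : \prod_(i < d) \prod_(j < d | j != i) F i j =
    \prod_(i < d) (\prod_(j < d | (i < j)%N) F i j) *
    \prod_(i < d) (\prod_(j < d | (j < i)%N) F i j).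
  rewrite -big_split /=; apply: eq_bigr => i _.
  rewrite (bigID (fun j : 'I_d => (i < j)%N)) /=; congr (_ * _);
    by apply: eq_bigl => j; rewrite -val_eqE /=; case: ltngtP.
(* Exchanging the indices turns the product over j < i into one over i < j with [F j i] as factor;
   symmetry then produces the square. *)
rewrite [X in _ = _ * X](exchange_big_dep xpredT) //= -big_split /=.
apply: eq_bigr => i _; rewrite -big_split /=; apply: eq_bigr => j _.
by rewrite expr2 {2}Fsym.
Qed.

Lemma prod_neq_const (R : comNzRingType) (d : nat) (i : 'I_d) (c : R) :
  \prod_(j < d | j != i) c = c ^+ d.-1.
Proof. by rewrite prodr_const (cardC1 i) card_ord. Qed.

Lemma max_le_mul (R : realDomainType) (a b : R) :
  1 <= a -> 1 <= b -> Num.max a b <= a * b.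
Proof.
by move=> a1 b1; rewrite ge_max ler_peMr ?ler_peMl // (le_trans ler01).
Qed.

(** The extra factor [w i] is either 1 or absorbed at the twin j, where the maximum is [w i] itself
    and [w i * w i] equals [w i * w j]. *)
Lemma prod_row_max_le (R : realDomainType) (d : nat) (w : 'I_d -> R)
    (i : 'I_d) :
  (forall j, 1 <= w j) -> w i = 1 \/ (exists2 j, j != i & w j = w i) ->
  w i * \prod_(j < d | j != i) Num.max (w i) (w j)
    <= \prod_(j < d | j != i) (w i * w j).
Proof.
move=> w_ge1 twin.
have w0 j : 0 <= w j by rewrite (le_trans ler01).
have max_bnd j : 0 <= Num.max (w i) (w j) <= w i * w j.
  by rewrite le_max w0 max_le_mul.
case: twin => [wi1|[j ji wji]].
  by rewrite {1}wi1 mul1r; apply: ler_prod.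
rewrite (bigD1 j) //= [leRHS](bigD1 j) //= wji maxxx mulrA.
by apply: ler_wpM2l; rewrite ?mulr_ge0 // ler_prod.
Qed.

Lemma prod_prod_max_le (R : realFieldType) (d : nat) (w : 'I_d -> R) :
  (2 <= d)%N -> (forall i, 1 <= w i) ->
  (forall i, w i = 1 \/ exists2 j, j != i & w j = w i) ->
  \prod_(i < d) \prod_(j < d | j != i) Num.max (w i) (w j)
    <= (\prod_(i < d) w i) ^+ (2 * d - 3).
Proof.
move=> d2 w_ge1 twin.
have w_gt0 j : 0 < w j by rewrite (lt_le_trans ltr01).
set W := \prod_(i < d) w i.
have W0 : 0 < W by apply: prodr_gt0.
have max0 i j : 0 <= Num.max (w i) (w j) by rewrite le_max ltW.
(* Multiplying by [W] gives each row the factor [w i] that the row bound absorbs, and raises the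
   exponent to 2d - 2, the one that w_i w_j yields over all ordered pairs. *)
rewrite -(ler_pM2l W0) -exprS -big_split /=.
apply: (@le_trans _ _ (\prod_(i < d) \prod_(j < d | j != i) (w i * w j))).
  apply: ler_prod => i _; rewrite prod_row_max_le // andbT.
  by rewrite mulr_ge0 ?prodr_ge0 // ltW.
under eq_bigr do rewrite big_split /= prod_neq_const.
rewrite big_split /= [X in _ * X](exchange_big_dep xpredT) //=.
have -> : \prod_(j < d) \prod_(i < d | j != i) w j = \prod_(j < d) w j ^+ d.-1.
  apply: eq_bigr => j _; under eq_bigl do rewrite eq_sym.
  exact: prod_neq_const.
rewrite prodrXl -/W -exprD.
by have -> : (d.-1 + d.-1 = (2 * d - 3).+1)%N by lia.
Qed.

(** * The Euclidean norm *)

Section Enorm.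
Variables (R : realType) (k : nat).
Implicit Types x y : 'rV[R]_k.


Lemma enorm_ge0 x : 0 <= enorm x. Proof. exact: sqrtr_ge0. Qed.

Lemma enorm_sqr x : enorm x ^+ 2 = \sum_(i < k) x 0 i ^+ 2.
Proof. by rewrite sqr_sqrtr // sumr_ge0 // => i _; exact: sqr_ge0. Qed.

Lemma enormN x : enorm (- x) = enorm x.
Proof.
by congr Num.sqrt; apply: eq_bigr => i _; rewrite mxE sqrrN.
Qed.

Lemma enorm_distC x y : enorm (x - y) = enorm (y - x).
Proof. by rewrite -enormN opprB. Qed.

(** The parallelogram law, with |x + y|^2 dropped, bounds |x - y|^2 by 2 (|x|^2 + |y|^2) coordinate
    by coordinate, without Cauchy-Schwarz. *)
Lemma enorm_sub_le x y : enorm (x - y) <= 2 * Num.max (enorm x) (enorm y).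
Proof.
rewrite -ler_sqr ?nnegrE ?enorm_ge0 ?mulr_ge0 ?le_max ?enorm_ge0 //.
have /le_trans-> // : enorm (x - y) ^+ 2 <= 2 * (enorm x ^+ 2 + enorm y ^+ 2).
  rewrite !enorm_sqr -big_split mulr_sumr; apply: ler_sum => i _ /=.
  rewrite !mxE; set a := x 0 i; set b := y 0 i.
  rewrite -subr_ge0 (_ : _ - _ = (a + b) ^+ 2) ?sqr_ge0 //; ring.
set M := Num.max _ _.
have -> : (2 * M) ^+ 2 = 2 * (M ^+ 2 + M ^+ 2) by ring.
have M0 : 0 <= M by rewrite le_max enorm_ge0.
by rewrite ler_pM2l // lerD // lerXn2r ?nnegrE ?enorm_ge0 // le_max lexx ?orbT.
Qed.

Lemma enorm_scale_delta (i : 'I_k) (a : R) : enorm (a *: delta_mx 0 i) = `|a|.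
Proof.
rewrite -sqrtr_sqr; congr Num.sqrt.
rewrite (bigD1 i) //= big1 ?addr0 => [|j /negPf ji].
  by rewrite !mxE !eqxx mulr1.
by rewrite !mxE ji andbF mulr0 expr0n.
Qed.

End Enorm.

(** * Upper bound for the discriminant *)

Lemma equal_length_twin (R : realType) (k d : nat) (alpha : 'I_d -> 'rV[R]_k)
    (A : {set 'I_d}) (i : 'I_d) :
  equal_length_pairs alpha A -> i \in A ->
  exists2 j, j != i & enorm (alpha j) = enorm (alpha i).
Proof.
case=> P /and3P[/eqP <- _ _] pairs /bigcupP[B PB].
have [a [b [ab -> nab]]] := pairs _ PB.
rewrite !inE => /orP[]/eqP->; first by exists b; rewrite // eq_sym.
by exists a.
Qed.

Lemma disc_le (R : realType) (k d : nat) (r : R) (alpha : 'I_d -> 'rV[R]_k) :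
  (2 <= d)%N -> 1 <= r -> admissible r alpha ->
  disc alpha <= (2 * r) ^+ (d * d.-1) * mahler alpha ^+ (2 * d - 3).
Proof.
move=> d2 r1 [_ pairs].
have r0 : 0 < r by rewrite (lt_le_trans ltr01).
pose w i := Num.max r (enorm (alpha i)) / r.
have w_ge1 i : 1 <= w i by rewrite ler_pdivlMr // mul1r le_max lexx.
have w_gt0 i : 0 < w i by rewrite (lt_le_trans ltr01).
have w_max i j : enorm (alpha i - alpha j) <= 2 * r * Num.max (w i) (w j).
  apply: le_trans (enorm_sub_le _ _) _; rewrite -mulrA ler_pM2l //.
  (* Here r max(w_i, w_j) is the maximum of r, |alpha_i| and |alpha_j|. *)
  rewrite /w -maxr_pMl ?invr_ge0 ?(ltW r0) // mulrC divfK ?gt_eqF //.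
  by rewrite ge_max !le_max !lexx !orbT.
have twin i : w i = 1 \/ exists2 j, j != i & w j = w i.
  have [le_r|gt_r] := leP (enorm (alpha i)) r.
    by left; rewrite /w max_l // divff ?gt_eqF.
  right; have [|j ji eij] := equal_length_twin (i := i) pairs.
    by rewrite inE.
  by exists j; rewrite // /w eij.
rewrite /disc prod_lt_symm; last by move=> *; exact: enorm_distC.
have -> : (2 * r) ^+ (d * d.-1) = \prod_(i < d) \prod_(j < d | j != i) (2 * r).
  under eq_bigr do rewrite prod_neq_const.
  by rewrite prodr_const card_ord -exprM mulnC.
apply: (@le_trans _ _ (\prod_(i < d) \prod_(j < d | j != i)
    (2 * r * Num.max (w i) (w j)))).
  apply: ler_prod => i _; rewrite prodr_ge0 => [|*]; last exact: enorm_ge0.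
  by apply: ler_prod => j _; rewrite enorm_ge0 w_max.
under eq_bigr do rewrite big_split /=.
rewrite big_split /= ler_wpM2l //.
  by apply: prodr_ge0 => *; apply: prodr_ge0 => *; rewrite mulr_ge0 // ltW.
apply: (le_trans (prod_prod_max_le d2 w_ge1 twin)).
have w_ge0 : 0 <= \prod_(i < d) w i by apply: prodr_ge0 => i _; exact: ltW.
have M_ge0 : 0 <= mahler alpha by apply: prodr_ge0 => i _; rewrite le_max ler01.
rewrite lerXn2r ?nnegrE //; apply: ler_prod => i _.
(* With m = max(1, |alpha_i|) and r >= 1, both r and |alpha_i| are at most m r, so w_i <= m. *)
rewrite ltW //= /w ler_pdivrMr // ge_max.
set m := Num.max 1 _.
have m1 : 1 <= m by rewrite le_max lexx.
have : enorm (alpha i) <= m by rewrite le_max lexx orbT.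
by nra.
Qed.

(** * The configuration showing sharpness *)

Section ExtremalConfiguration.
Variables (R : realType) (d : nat) (t : R).

Definition extremal_coord (i : nat) : R :=
  if i == 0%N then t else if i == 1%N then - t else i%:R / d%:R.

Lemma extremal_coord_small (i : nat) :
  (1 < i < d)%N -> 0 <= extremal_coord i <= 1.
Proof.
case: i => [|[|i]] // /andP[_ id]; rewrite /extremal_coord /= divr_ge0 //=.
by rewrite ler_pdivrMr ?ltr0n ?mul1r ?ler_nat; lia.
Qed.

(** If i < 2, the distance is at least t - 1 >= t / 2. Weakening this to t / d gives the same
    denominator as the spacing 1 / d of the fixed points, so the discriminant bound splits into a
    constant and a power of t. *)
Lemma extremal_coord_dist (i j : nat) :
  (2 <= d)%N -> 2 <= t -> (i < j < d)%N ->
  (if (i < 2)%N then t else 1) / d%:R <= `|extremal_coord i - extremal_coord j|.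
Proof.
move=> d2 t2 /andP[ij jd].
have dR_gt0 : 0 < d%:R :> R by rewrite ltr0n; lia.
have t_gt0 : 0 < t by lra.
have td : t / d%:R <= t / 2.
  by rewrite ler_pM2l ?lef_pV2 ?posrE ?ler_nat.
case: i ij => [|[|i]] ij /=.
- rewrite (le_trans td) // (_ : extremal_coord 0 = t) //.
  case: j ij jd => [|[|j]] // ij jd.
    by rewrite /extremal_coord /= ger0_norm; lra.
  by have /andP[? ?] := @extremal_coord_small j.+2 jd; rewrite ger0_norm; lra.
- have /andP[? ?] : 0 <= extremal_coord j <= 1.
    by apply: extremal_coord_small; rewrite ij.
  by rewrite (le_trans td) // (_ : extremal_coord 1 = - t) // ler0_norm; lra.
case: j ij jd => [|[|j]] // ij jd; rewrite /extremal_coord /= distrC -mulrBl.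
rewrite normrM (ger0_norm (_ : 0 <= d%:R^-1)) ?invr_ge0 ?(ltW dR_gt0) //.
by rewrite ler_pM2r ?invr_gt0 // -natrB 1?ltnW // normr_nat ler1n subn_gt0.
Qed.

Variables (k : nat) (i0 : 'I_k).

Definition extremal (i : 'I_d) : 'rV[R]_k := extremal_coord i *: delta_mx 0 i0.

Lemma enorm_extremal (i : 'I_d) : enorm (extremal i) = `|extremal_coord i|.
Proof. exact: enorm_scale_delta. Qed.

Lemma norm_extremal_coord_small (i : 'I_d) :
  (1 < i)%N -> `|extremal_coord i| <= 1.
Proof.
move=> i1; have /andP[? ?] : 0 <= extremal_coord i <= 1.
  by apply: extremal_coord_small; rewrite i1 /=.
by rewrite ger0_norm.
Qed.

Lemma norm_extremal_coord_large (i : 'I_d) :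
  2 <= t -> (i < 2)%N -> `|extremal_coord i| = t.
Proof.
move=> t2.
have t0 : 0 <= t by lra.
by case: (val i) => [|[|]] // _; rewrite /extremal_coord /= ?normrN ger0_norm.
Qed.

Lemma mahler_extremal :
  (2 <= d)%N -> 2 <= t -> mahler extremal = t ^+ 2.
Proof.
move=> d2 t2.
have -> : mahler extremal = \prod_(i < d) (if (i < 2)%N then t else 1).
  apply: eq_bigr => i _; rewrite enorm_extremal; case: ltnP => i2.
    by rewrite norm_extremal_coord_large // max_r //; lra.
  by rewrite max_l // norm_extremal_coord_small.
have -> : d = (2 + (d - 2))%N by lia.
by rewrite big_split_ord /= big_ord_recl big_ord1 big1 ?mulr1 ?expr2.
Qed.

Lemma admissible_extremal (r : R) :
  (2 <= d)%N -> 2 <= t -> 1 <= r < t -> admissible r extremal.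
Proof.
move=> d2 t2 /andP[r1 rt].
have d_gt0 : (0 < d)%N by lia.
pose a : 'I_d := Ordinal d_gt0; pose b : 'I_d := Ordinal d2.
have ab : a != b by [].
rewrite /admissible (_ : longer r extremal = [set a; b]); last first.
  apply/setP => i; rewrite !inE enorm_extremal -!val_eqE /=.
  case: (ltnP i 2) => i2.
    by rewrite norm_extremal_coord_large // rt; case: (val i) i2 => [|[|]].
  rewrite ltNge (le_trans (norm_extremal_coord_small i2)) //.
  by case: (val i) i2 => [|[|]].
split; first by rewrite cards2 ab.
exists [set [set a; b]].
  rewrite /partition /trivIset /cover !big_set1 !eqxx inE /=.
  by rewrite eq_sym; apply/set0Pn; exists a; rewrite !inE eqxx.
move=> B /set1P ->; exists a, b; split=> //.
by rewrite !enorm_extremal !norm_extremal_coord_large.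
Qed.

(** There are (d - 1) + (d - 2) = 2d - 3 pairs with smaller index 0 or 1, each contributing at least
    t^2 / d^2; every other pair contributes at least 1 / d^2. *)
Lemma disc_extremal_ge :
  (2 <= d)%N -> 2 <= t ->
  (\prod_(i < d) \prod_(j < d | (i < j)%N) d%:R ^- 2) * t ^+ (4 * d - 6)
    <= disc extremal.
Proof.
move=> d2 t2.
have dR_gt0 : 0 < d%:R :> R by rewrite ltr0n; lia.
pose c (i : nat) : R := if (i < 2)%N then t else 1.
have c_ge0 i : 0 <= c i by rewrite /c; case: ifP => _; lra.
have -> : t ^+ (4 * d - 6) = \prod_(i < d) \prod_(j < d | (i < j)%N) c i ^+ 2.
  have row (i : nat) (x : R) : \prod_(j < d | (i < j)%N) x = x ^+ (d - i.+1).
    by rewrite -(big_geq_mkord _ _ xpredT (fun=> x)) prodr_const_nat.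
  under eq_bigr do rewrite row -exprM.
  rewrite -(big_mkord xpredT (fun i => c i ^+ (2 * (d - i.+1)))).
  rewrite big_ltn ?(ltnW d2) // big_ltn // big_nat big1 => [|i /andP[i2 _]].
    by rewrite mulr1 /c /= -exprD; congr (_ ^+ _); lia.
  by rewrite /c ltnNge i2 expr1n.
rewrite -big_split /=; apply: ler_prod => i _; rewrite -big_split /=.
rewrite prodr_ge0 => [|j _] /=; last first.
  by rewrite mulr_ge0 ?invr_ge0 ?exprn_ge0 // ltW.
apply: ler_prod => j ij.
rewrite mulr_ge0 ?invr_ge0 ?exprn_ge0 ?(ltW dR_gt0) //=.
rewrite -exprVn -exprMn mulrC /extremal -scalerBl enorm_scale_delta.
rewrite lerXn2r ?nnegrE ?divr_ge0 ?(ltW dR_gt0) //.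
by rewrite extremal_coord_dist // ij /=.
Qed.

End ExtremalConfiguration.

Theorem theorem2p1 (R : realType) (k d : nat) (r : R)
    (hk : (0 < k)%N) (hd : (2 <= d)%N) (hr : 1 <= r) :
  (forall alpha : 'I_d -> 'rV[R]_k, admissible r alpha ->
     mahler alpha `^ (2 * d%:R - 3)
       >= (2 * r) ^ (d%:Z * (1 - d%:Z)) * disc alpha)
  /\
  (* no smaller exponent works, whatever the multiplicative constant; the
     constant of the inequality is [c := (2 * r) ^ (d%:Z * (1 - d%:Z))] *)
  (forall e c : R, e < 2 * d%:R - 3 -> 0 < c ->
     exists2 alpha : 'I_d -> 'rV[R]_k, admissible r alpha &
       mahler alpha `^ e < c * disc alpha).
Proof.
split=> [alpha adm | e c e_lt c_gt0].
  have -> : 2 * d%:R - 3 = (2 * d - 3)%:R :> R by rewrite natrB ?natrM //; lia.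
  rewrite powR_mulrn; last by apply: prodr_ge0 => i _; rewrite le_max ler01.
  have -> : d%:Z * (1 - d%:Z) = - (d * d.-1)%:Z by nia.
  rewrite -exprnN mulrC ler_pdivrMr 1?mulrC; last by rewrite exprn_gt0 //; lra.
  exact: disc_le.
pose K : R := \prod_(i < d) \prod_(j < d | (i < j)%N) d%:R ^- 2.
have cK_gt0 : 0 < c * K.
  rewrite mulr_gt0 // prodr_gt0 // => i _; rewrite prodr_gt0 // => j _.
  by rewrite invr_gt0 exprn_gt0 // ltr0n; lia.
(* The growth exponent in t of the discriminant bound minus that of the Mahler side, t^(2e). *)
pose delta : R := (4 * d - 6)%:R - 2 * e.
have delta_gt0 : 0 < delta by rewrite /delta natrB ?natrM; [lra|lia].
(* Chosen so that c K s^delta = 1; then any t > s gives c K t^delta > 1. The summand r + 1 in [t]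
   also ensures t > r and t >= 2. *)
pose s := (c * K)^-1 `^ delta^-1.
have s_ge0 : 0 <= s by exact: powR_ge0.
pose t := r + 1 + s.
have t2 : 2 <= t by rewrite /t; lra.
have rt : 1 <= r < t by rewrite hr /t; lra.
have t0 : 0 <= t by lra.
exists (extremal t (Ordinal hk)); first exact: admissible_extremal.
rewrite mahler_extremal //.
apply: lt_le_trans (_ : _ < c * (K * t ^+ (4 * d - 6))) _; last first.
  by rewrite ler_pM2l // disc_extremal_ge.
rewrite -powR_mulrn // -powRrM -[t ^+ _]powR_mulrn //.
have -> : (4 * d - 6)%:R = 2 * e + delta :> R by rewrite /delta; ring.
rewrite powRD; last by apply/implyP => _; lra.
(* Cancelling t^(2e) leaves 1 < c K t^delta. *)
rewrite mulrA mulrCA ltr_pMr ?powR_gt0 //; last lra.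
have : s `^ delta < t `^ delta.
  by rewrite gt0_ltr_powR ?nnegrE // /t; lra.
rewrite /s -powRrM mulVf ?gt_eqF // powRr1 ?invr_ge0 ?(ltW cK_gt0) //.
by rewrite -ltr_pdivrMl // mulr1.
Qed.
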